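(* Let $p$ be a prime and let $G$ be a $p$-group of order $p^e$, with $p$ dividing $|G|$. If $g_1, g_2 \in G$ are such that $\chi(g_1) \equiv \chi(g_2) \mod p^{e+1}$ for all unramified characters $\chi$ of $G$ (at $p$), then $g_1$ and $g_2$ are $\Gamma$-conjugate.
   Context: For a finite group $G$ and a prime $p$, write $|G| = r p^e$ with $r$ prime to $p$, and let $\Gamma$ be the kernel of the projection $(\mathbb{Z}/|G|\mathbb{Z})^\times \to (\mathbb{Z}/r\mathbb{Z})^\times$ (so here $r=1$ and $\Gamma = (\mathbb{Z}/p^e\mathbb{Z})^\times$). Two elements of $G$ are $\Gamma$-conjugate if they are equivalent under the equivalence relation on $G$ generated by conjugation and $x \sim x^s$ for $s \in \Gamma$. For a complex character $\chi$ of $G$, $\mathbb{Q}(\chi)$ is the field generated over $\mathbb{Q}$ by the values of $\chi$; $\chi$ is unramified (at $p$) if $\mathbb{Q}(\chi)/\mathbb{Q}$ is unramified at $p$ (equivalently, $\chi$ is constant on $\Gamma$-conjugacy classes). For algebraic integers $a,b$, $a \equiv b \mod p^m$ means that $(a-b)/p^m$ is an algebraic integer. *)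

(* Defs.v *)
From Stdlib Require Import Relations.Relation_Operators.
From HB Require Import structures.
From mathcomp Require Import all_boot all_order all_algebra all_fingroup.
From mathcomp Require Import all_solvable all_field all_character.

Set Implicit Arguments.
Unset Strict Implicit.
Unset Printing Implicit Defensive.

Import Order.TTheory GRing.Theory Num.Theory.

Local Open Scope ring_scope.

(* Subsets of algC are Prop-valued predicates, because membership in a        *)
(* generated field or in an arbitrary ideal need not be given as a boolean.   *)

(* As 0^-1 = 0 in algC, closure under division needs no side condition.       *)
Definition is_subfield (K : algC -> Prop) : Prop :=
  [/\ K 1,
      forall x y, K x -> K y -> K (x - y)
    & forall x y, K x -> K y -> K (x / y)].

(* Subfields contain 1, hence the prime field, so this is Q(S).               *)
Definition field_generated (S : algC -> Prop) (x : algC) : Prop :=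
  forall K : algC -> Prop, is_subfield K -> (forall y, S y -> K y) -> K x.

Definition ring_of_integers (K : algC -> Prop) (x : algC) : Prop :=
  K x /\ x \in Aint.

Definition is_ideal (R I : algC -> Prop) : Prop :=
  [/\ forall x, I x -> R x,
      I 0,
      forall x y, I x -> I y -> I (x + y)
    & forall a x, R a -> I x -> I (a * x)].

Definition is_prime_ideal (R P : algC -> Prop) : Prop :=
  [/\ is_ideal R P,
      ~ P 1
    & forall x y, R x -> R y -> P (x * y) -> P x \/ P y].

Definition ideal_mul (I J : algC -> Prop) (x : algC) : Prop :=
  exists (n : nat) (a b : 'I_n -> algC),
    [/\ forall i, I (a i), forall i, J (b i) & x = \sum_(i < n) a i * b i].

Fixpoint ideal_exp (R I : algC -> Prop) (n : nat) : algC -> Prop :=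
  if n is m.+1 then ideal_mul I (ideal_exp R I m) else R.

(* e is the exponent of P in the factorization of p * O_K: it is the largest  *)
(* e such that P ^ e contains p.                                              *)
Definition is_ramification_index (K P : algC -> Prop) (p e : nat) : Prop :=
  ideal_exp (ring_of_integers K) P e p%:R /\
  ~ ideal_exp (ring_of_integers K) P e.+1 p%:R.

(* Intended for a number field K and a prime number p. The residue field      *)
(* extensions at p are then extensions of finite fields, hence separable, so  *)
(* only the ramification indices matter.                                      *)
Definition unramified_at (p : nat) (K : algC -> Prop) : Prop :=
  forall P : algC -> Prop,
    is_prime_ideal (ring_of_integers K) P -> P p%:R ->
    is_ramification_index K P p 1.

Definition char_field (gT : finGroupType) (G : {group gT}) (chi : 'CF(G)) :
    algC -> Prop :=
  field_generated (fun y => exists2 x, x \in G & y = chi x).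

Definition unramified_char (p : nat) (gT : finGroupType) (G : {group gT})
    (chi : 'CF(G)) : Prop :=
  unramified_at p (char_field chi).

(* s represents an element of the kernel of (Z/|G|)^* -> (Z/r)^*, where       *)
(* r = #|G|`_p^' is the largest divisor of |G| prime to p. Natural number     *)
(* representatives are used since 'Z_n is not Z/n for n = 1; for x \in G,     *)
(* x ^+ s depends only on s modulo |G|.                                       *)
Definition in_Gamma (p : nat) (gT : finGroupType) (G : {group gT}) (s : nat) :
    bool :=
  coprime #|G| s && (s == 1 %[mod #|G|`_p^'])%N.

Definition Gamma_step (p : nat) (gT : finGroupType) (G : {group gT})
    (x y : gT) : Prop :=
  [/\ x \in G, y \in G
    & (exists2 z, z \in G & y = (x ^ z)%g) \/
      (exists2 s, in_Gamma p G s & y = (x ^+ s)%g)].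

(* To be used on elements of G (elsewhere it only relates x to itself).       *)
Definition Gamma_conjugate (p : nat) (gT : finGroupType) (G : {group gT}) :
    gT -> gT -> Prop :=
  clos_refl_sym_trans gT (Gamma_step p G).

(* Main.v *)
Require Import Defs.
From mathcomp Require Import all_boot all_order all_algebra all_fingroup.
From mathcomp Require Import all_solvable all_field all_character.
From Stdlib Require Import Relations.Relation_Operators.

(** Let C be the set of the x in G such that <[x]> is conjugate to <[g1]>; as G
    is a p-group, all elements of C are Gamma-conjugate to g1
    ([conj_cycle_Gamma_conjugate]).  It is therefore enough to find an
    unramified character that separates C from its complement modulo
    p ^ e.+1.

    The class function #|G| '1_C has the right values, but it is only a
    virtual character.  Its coefficient on 'chi_i is the sum of the conjugates
    of 'chi_i over C, an algebraic integer; since C is stable under powers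
    prime to #|G|, this sum is fixed by every Galois automorphism
    ([sum_char_rat]), so it is a rational integer.  Its absolute value is at
    most #|G| 'chi_i(1), so adding #|G| times the regular character makes every
    coefficient nonnegative:
      psi = #|G| ('1_C + cfReg G)
    is a genuine character ([cfuni_add_reg_char]).  It visibly has rational
    values, hence is unramified ([rat_char_unramified]).  The regular character
    vanishes away from 1 and has degree #|G|, which is divisible by p.  So, if
    g2 were not in C, the difference psi g1 - psi g2 would be p ^ e (1 + p k)
    for some integer k, and could not be divisible by p ^ e.+1. *)

Set Implicit Arguments.
Unset Strict Implicit.
Unset Printing Implicit Defensive.

Import Order.TTheory GRing.Theory Num.Theory.

Local Open Scope ring_scope.

(** The restriction of phi to <[x]> is a sum of linear characters, whose values
    at x are #[x]-th roots of unity; on these both sides agree. *)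
Lemma char_expg (gT : finGroupType) (G : {group gT}) (phi : 'CF(G))
    (u : {rmorphism algC -> algC}) (s : nat) (x : gT) :
    phi \is a character -> x \in G ->
    (forall z, z ^+ #[x]%g = 1 -> u z = z ^+ s) ->
  u (phi x) = phi (x ^+ s)%g.
Proof.
move=> Nphi Gx u_root.
have sxG : <[x]>%g \subset G by rewrite cycle_subG.
have xx := cycle_id x; have xsx := mem_cycle x s.
rewrite -(cfResE phi sxG xx) -(cfResE phi sxG xsx).
have /char_sum_irr[r ->] := cfRes_char <[x]>%G Nphi.
rewrite !sum_cfunE rmorph_sum; apply: eq_bigr => i _.
have lin_i : 'chi_i \is a linear_char by apply/char_abelianP/cycle_abelian.
rewrite lin_charX //; apply: u_root.
by rewrite -lin_charX // expg_order lin_char1.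
Qed.

(** A Galois automorphism u raises the #|G|-th roots of unity to some power s
    prime to #|G|, so it maps phi x to phi (x ^+ s).  As x |-> x ^+ s permutes
    C, the sum is fixed by the Galois group of a number field containing the
    values of phi. *)
Lemma sum_char_rat (gT : finGroupType) (G : {group gT}) (phi : 'CF(G))
    (C : {set gT}) :
    phi \is a character -> C \subset G ->
    (forall x s, x \in C -> coprime #|G| s -> (x ^+ s)%g \in C) ->
  \sum_(x in C) phi x \in Crat.
Proof.
move=> Nphi /subsetP sCG Cpow.
have [Qn galQn [QnC nuC [w _ QnG]]] := group_num_field_exists G.
have [a Da]: exists a, QnC a = \sum_(x in C) phi x.
  have /fin_all_exists[a Da] x : exists a, x \in C -> QnC a = phi x.
    have [Cx | _] := boolP (x \in C); last by exists 0.
    by have [a] := QnG _ _ _ Nphi x (order_dvdG (sCG x Cx)); exists a.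
  by exists (\sum_(x in C) a x); rewrite rmorph_sum; apply: eq_bigr => x /Da.
suffices: a \in 1%VS.
  by case/vlineP=> c Dc; rewrite -Da Dc alg_num_field fmorph_rat Crat_rat.
rewrite -(galois_fixedField galQn); apply/fixedFieldP=> [|nu _].
  exact: memvf.
apply: (fmorph_inj QnC); have [u /= ->] := nuC nu.
have [z prim_z] := C_prim_root_exists (cardG_gt0 G).
have [s co_s Dus] := aut_prim_rootP u prim_z.
have u_root x : x \in C -> u (phi x) = phi (x ^+ s)%g.
  move=> Cx; apply: char_expg => // [|y y1]; first exact: sCG.
  have [|i ->] := prim_rootP prim_z (x := y).
    by have /dvdnP[m ->] := order_dvdG (sCG x Cx); rewrite mulnC exprM y1 expr1n.
  by rewrite rmorphXn /= Dus exprAC.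
have co_Gs : coprime #|G| s by rewrite coprime_sym.
have inj_s : {in C &, injective (fun x => x ^+ s)%g}.
  by apply: sub_in2 (can_in_inj (expgK co_Gs)); apply: sCG.
have imC : [set (x ^+ s)%g | x in C] = C.
  apply/eqP; rewrite eqEcard card_in_imset // leqnn andbT.
  by apply/subsetP=> _ /imsetP[x Cx ->]; apply: Cpow.
by rewrite Da rmorph_sum (eq_bigr _ u_root) -[in RHS]imC big_imset.
Qed.

(** The coefficient of #|G| '1_C on 'chi_i is a rational integer by
    [sum_char_rat]; the triangle inequality bounds it by #|G| 'chi_i(1), which
    is exactly the coefficient of #|G| cfReg G.  Hence the total is a natural
    number. *)
Lemma cfuni_add_reg_char (gT : finGroupType) (G : {group gT}) (C : {set gT}) :
    (C <| G)%g ->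
    (forall x s, x \in C -> coprime #|G| s -> (x ^+ s)%g \in C) ->
  #|G|%:R *: ('1_C + cfReg G) \is a character.
Proof.
move=> nsCG Cpow; have sCG := normal_sub nsCG.
rewrite [_ *: _]cfun_sum_cfdot; apply: rpred_sum => i _.
set b := '[_, _]; suffices /natrP[n ->]: b \in Num.nat.
  by rewrite scaler_nat rpredMn // irr_char.
have nzG : #|G|%:R != 0 :> algC by rewrite pnatr_eq0 -lt0n.
pose S := \sum_(x in C) ('chi_i)^*%CF x.
have N_i : ('chi_i)^*%CF \is a character by rewrite cfConjC_char irr_char.
have Db : b = S + #|G|%:R * 'chi_i 1%g.
  rewrite /b cfdotZl cfdotDl mulrDr; congr (_ + _ * _).
    rewrite (cfdotEl _ (cfuni_on G C)) mulVKf //; apply: eq_bigr => x Cx.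
    by rewrite cfuniE // Cx mul1r cfunE.
  rewrite cfReg_sum cfdot_suml (bigD1 i) //= cfdotZl cfdot_irr eqxx mulr1.
  by rewrite big1 ?addr0 // => j ji; rewrite cfdotZl cfdot_irr (negPf ji) mulr0.
have S_int : S \in Num.int.
  apply: Cint_rat_Aint; first exact: sum_char_rat.
  by apply: rpred_sum => x _; apply: Aint_char.
have chi1_nat : 'chi_i 1%g \in Num.nat by rewrite Cnat_irr1.
rewrite natrEint Db (rpredD S_int) ?rpredM ?rpred_nat ?intr_nat //=.
have S_real : S \is Num.real by rewrite Rreal_int.
have: `|S| <= #|G|%:R * 'chi_i 1%g.
  apply: le_trans (ler_norm_sum _ _ _) _.
  apply: (@le_trans _ _ (\sum_(x in C) 'chi_i 1%g)).
    apply: ler_sum => x _; apply: le_trans (char1_ge_norm x N_i) _.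
    by rewrite cfAut_irr1.
  rewrite sumr_const -[X in X <= _]mulr_natl.
  apply: ler_wpM2r; first exact: natr_ge0.
  by rewrite ler_nat subset_leq_card.
by rewrite real_ler_norml // => /andP[le_S _]; rewrite -lerBlDr sub0r.
Qed.

(** The field of values is Q, with ring of integers Z, where the only prime ideal
    containing p is (p), and p is not divisible by p ^ 2. *)
Lemma rat_char_unramified (p : nat) (gT : finGroupType) (G : {group gT})
    (chi : 'CF(G)) :
  prime p -> (forall x, x \in G -> chi x \in Crat) -> unramified_char p chi.
Proof.
move=> p_prime chi_rat P [[PK P0 PD PM] P1 _] Pp.
set R := ring_of_integers _ in PK PM *.
have K_rat x : char_field chi x -> x \in Crat.
  move/(_ [in Crat]); apply=> [|_ [y Gy ->]]; last exact: chi_rat.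
  by split=> [|x1 x2|x1 x2]; [apply: rpred1 | apply: rpredB | apply: rpred_div].
have R_int x : R x -> x \in Num.int.
  by case=> /K_rat rat_x; apply: Cint_rat_Aint.
have R1 : R 1 by split; [move=> K [] | apply: rpred1].
have R_sub x y : R x -> R y -> R (x - y).
  case=> Kx Ax [Ky Ay]; split; last exact: rpredB.
  by move=> K sfK sK; have [_ KB _] := sfK; apply: KB; [apply: Kx | apply: Ky].
have R_nat n : R n%:R.
  have R0 : R 0 by rewrite -(subrr 1); apply: R_sub.
  elim: n => // n IHn; have -> : n.+1%:R = n%:R - (0 - 1) :> algC by rewrite sub0r opprK natr1.
  by apply: (R_sub _ _ IHn); apply: R_sub.
have R_of_int (m : int) : R m%:~R.
  case: m => n; rewrite ?NegzE ?intrN -?pmulrn //.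
  by rewrite -sub0r; apply: R_sub (R_nat 0%N) (R_nat _).
(* By Bezout, an integer prime to p in P would put 1 in P. *)
have P_div x : P x -> exists m : int, x = p%:R * m%:~R.
  move=> Px; have /intrP[n Dn] := R_int x (PK x Px).
  have [/dvdzP[m Dm] | ndv] := boolP (p%:Z %| n)%Z.
    by exists m; rewrite Dn Dm intrM mulrC.
  case: P1; have: coprimez n p.
    by rewrite coprimezE coprime_sym prime_coprime // -dvdzE.
  case/coprimezP=> [[a b]] /= Dab.
  rewrite (_ : 1 = a%:~R * x + b%:~R * p%:R); first by apply: PD; apply: PM.
  by rewrite Dn (pmulrn _ p) -!intrM -intrD Dab.
split.
  by exists 1%N, (fun=> p%:R), (fun=> 1); split=> //; rewrite big_ord1 mulr1.
case=> n [a [b [Pa Pb Dp]]].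
have Pb_ i : P (b i).
  have [m [c [d [Pc Rd ->]]]] := Pb i.
  by apply: (big_ind P) => // j _; rewrite mulrC; apply: PM (Rd j) (Pc j).
have /fin_all_exists[k Dk] i : exists k : int, a i * b i = (p ^ 2)%:R * k%:~R.
  have [[ka ->] [kb ->]] := (P_div _ (Pa i), P_div _ (Pb_ i)).
  by exists (ka * kb); rewrite mulrACA -natrM -intrM.
have: p%:Z = (p ^ 2)%N%:Z * (\sum_i k i).
  apply: (@intr_inj algC); rewrite intrM -!pmulrn Dp.
  rewrite (eq_bigr _ (fun i _ => Dk i)).
  by rewrite -mulr_sumr -rmorph_sum.
move/(congr1 absz); rewrite abszM /= => Dp2.
have: (p ^ 2 %| p ^ 1)%N by rewrite expn1 {2}Dp2 dvdn_mulr.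
by rewrite (dvdn_Pexp2l _ _ (prime_gt1 p_prime)).
Qed.

(** A generator of the cyclic group <[x ^ z]> is a power (x ^ z) ^+ s with s prime
    to the order of x; in a p-group this makes s prime to #|G|, unless x = 1,
    and the condition modulo the p'-part of #|G| is empty. *)
Lemma conj_cycle_Gamma_conjugate (p : nat) (gT : finGroupType) (G : {group gT})
    (x y : gT) :
    prime p -> (p.-group G)%g -> x \in G -> y \in G ->
    (<[y]> \in <[x]> :^: G)%g ->
  Gamma_conjugate p G x y.
Proof.
move=> p_prime pG Gx Gy /imsetP[z Gz]; rewrite -cycleJ => Dy.
have Gxz : (x ^ z)%g \in G by rewrite groupJ.
apply: (rst_trans _ _ _ (x ^ z)%g).
  by apply: rst_step; split=> //; left; exists z.
have: generator <[x ^ z]> y by rewrite /generator Dy.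
have /cycleP[s ->] : y \in <[x ^ z]>%g by rewrite -Dy cycle_id.
rewrite generator_coprime => co_s.
have [-> | nt_xz] := eqVneq (x ^ z)%g 1%g.
  by rewrite expg1n; apply: rst_refl.
apply: rst_step; split; rewrite ?groupX //; right; exists s => //.
rewrite /in_Gamma part_p'nat ?modn1 ?andbT; last by rewrite pnatNK.
have p_xz := mem_p_elt pG Gxz.
have [n Dn] := p_natP pG; rewrite Dn coprimeXl //.
apply: coprime_dvdl co_s.
have /p_natP[[|k] Dk] := p_xz; last by rewrite Dk expnS dvdn_mulr.
by rewrite -order_eq1 Dk in nt_xz.
Qed.

Theorem proposition3p2 (p e : nat) (gT : finGroupType) (G : {group gT})
    (p_prime : prime p) (pG : (p.-group G)%g) (oG : #|G| = (p ^ e)%N)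
    (p_dvd_G : (p %| #|G|)%N) (g1 g2 : gT) (g1G : g1 \in G) (g2G : g2 \in G)
    (chi_congr : forall chi : 'CF(G),
       chi \is a character -> unramified_char p chi ->
       (chi g1 == chi g2 %[mod (p ^ e.+1)%:R])%A) :
  Gamma_conjugate p G g1 g2.
Proof.
pose C := [set x in G | <[x]>%g \in (<[g1]> :^: G)%g].
have nsCG : (C <| G)%g.
  apply/andP; split; first by apply/subsetP=> x; rewrite inE => /andP[].
  apply/normsP=> z Gz; apply/setP=> x; rewrite mem_conjg !inE groupJr ?groupV //.
  rewrite cycleJ; congr (_ && _); apply/imsetP/imsetP=> [[y Gy Dy] | [y Gy ->]].
    by exists (y * z)%g; rewrite ?groupM // conjsgM -Dy conjsgKV.
  by exists (y * z^-1)%g; rewrite ?groupM ?groupV // conjsgM.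
have Cpow x s : x \in C -> coprime #|G| s -> (x ^+ s)%g \in C.
  rewrite !inE => /andP[Gx Cx] co_s; rewrite groupX //=.
  have: generator <[x]> (x ^+ s).
    by rewrite generator_coprime (coprime_dvdl (order_dvdG Gx)).
  by move/eqP<-.
have Cg1 : g1 \in C.
  by rewrite inE g1G; apply/imsetP; exists 1%g; rewrite ?group1 ?conjsg1.
have [|notCg2] := boolP (g2 \in C).
  by rewrite inE => /andP[_]; apply: conj_cycle_Gamma_conjugate.
set psi := #|G|%:R *: ('1_C + cfReg G) : 'CF(G).
have Dpsi x : psi x = #|G|%:R * ((x \in C)%:R + #|G|%:R *+ (x == 1%g)).
  by rewrite cfunE [X in _ * X]cfunE cfRegE cfuniE.
have: (psi g1 == psi g2 %[mod (p ^ e.+1)%:R])%A.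
  apply: chi_congr; first exact: cfuni_add_reg_char.
  apply: rat_char_unramified => // x _.
  by rewrite Dpsi rpredM ?rpredD ?rpredMn ?rpred_nat.
have [n oGn] := dvdnP p_dvd_G.
pose k : int := n%:Z * ((g1 == 1%g)%:Z - (g2 == 1%g)%:Z).
have -> : psi g1 = psi g2 + (p ^ e)%:R * (1 + p%:Z * k)%:~R.
  rewrite !Dpsi Cg1 (negPf notCg2) add0r -[in RHS]oG -mulrDr; congr (_ * _).
  rewrite /k mulrA -PoszM mulnC -oGn rmorphD rmorphM rmorphB /= -!pmulrn.
  by rewrite -!(mulr_natr #|G|%:R) mulrBr addrCA subrKC.
rewrite /eqAmod addrAC subrr add0r unfold_in pnatr_eq0 expn_eq0.
rewrite -[(p == 0)%N]negbK -lt0n prime_gt0 //=.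
have pC0 : p%:R != 0 :> algC by rewrite pnatr_eq0 -lt0n prime_gt0.
rewrite expnSr natrM -mulf_div divff ?mul1r => [Zq|]; last first.
  by rewrite natrX expf_neq0.
have /intrP[m Dm]: (1 + p%:Z * k)%:~R / p%:R \in (Num.int : {pred algC}).
  apply: Cint_rat_Aint Zq; apply: rpred_div; last exact: rpred_nat.
  by apply: rpred_int.
have: (p %| 1)%Z.
  have Dmp : 1 + p%:Z * k = m * p.
    by apply: (@intr_inj algC); rewrite [RHS]intrM -Dm -pmulrn divfK.
  rewrite (_ : 1%Z = m * p - p%:Z * k); last by rewrite -Dmp addrK.
  by apply: rpredB; [apply: dvdz_mull | apply: dvdz_mulr]; apply: dvdzz.
by rewrite dvdzE /= dvdn1 => /eqP p1; rewrite p1 in p_prime.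
Qed.
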